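(* Let $k$ be a field, $\delta\in k$ and $r,s,n,m\in\mathbb{N}$. The twisted tensor product $B_{r,s}(\delta)\boxtimes B_{n,m}(\delta)$ is a subalgebra of the walled Brauer algebra $B_{r+n,s+m}(\delta)$, and it is isomorphic to the ordinary tensor product algebra $B_{r,s}(\delta)\otimes_k B_{n,m}(\delta)$ as a $k$-algebra.
   Context: Walled Brauer algebra. An $N$-diagram is a partition of $\{1,\dots,N,\bar 1,\dots,\bar N\}$ into pairs, drawn with a top row of dots $1,\dots,N$ and a bottom row of dots $\bar1,\dots,\bar N$ (left to right), each pair being joined by an edge. An edge is a propagating edge if it joins dots of different rows, and an arc otherwise. The Brauer algebra $B_N(\delta)$ has the $N$-diagrams as $k$-basis; the product $A\cdot B$ of two diagrams is $\delta^t C$, obtained by stacking $A$ on top of $B$, identifying the bottom dots of $A$ with the top dots of $B$, where $t$ is the number of closed curves created and $C$ is the diagram left after removing them. For $r,s\in\mathbb{N}$, put a vertical wall separating the first $r$ top and bottom dots from the remaining $s$. An $(r,s)$-walled (Brauer) diagram is an $(r+s)$-diagram in which no propagating edge crosses the wall and every arc crosses the wall. The walled Brauer algebra $B_{r,s}(\delta)$ is the subalgebra of $B_{r+s}(\delta)$ spanned by the $(r,s)$-walled diagrams. Maps $\iota$ and $\zeta$. Let $I_n$ be the identity $n$-diagram ($n$ vertical edges). For an $(r,s)$-walled diagram $D$, $\iota_{n,m}(D)$ is the $(r+n,s+m)$-walled diagram obtained from $D$ by inserting $I_n$ immediately to the left of the wall and $I_m$ immediately to the right of the wall (so in each row the first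 $r$ and last $s$ dots carry $D$, and the middle $n+m$ dots are joined vertically). The diagram $\zeta_{n,m}(D)$ is the $(r+n,s+m)$-walled diagram obtained by juxtaposing $I_n$ to the left of $D$ and $I_m$ to the right of $D$. Twisted tensor product. For an $(r,s)$-walled diagram $D$ and an $(n,m)$-walled diagram $D'$, set $D\boxtimes D':=\iota_{n,m}(D)\cdot\zeta_{r,s}(D')$, an $(r+n,s+m)$-walled diagram. $B_{r,s}(\delta)\boxtimes B_{n,m}(\delta)$ denotes the twisted tensor product algebra obtained by extending $\boxtimes$ linearly, i.e. the $k$-span of all $D\boxtimes D'$ inside $B_{r+n,s+m}(\delta)$. *)

(* Defs.v *)
From HB Require Import structures.
From mathcomp Require Import all_boot all_algebra falgebra zify.

Set Implicit Arguments.
Unset Strict Implicit.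
Unset Printing Implicit Defensive.

Import GRing.Theory.

(* In the graph whose edges join u to a u and to b u, for involutions a and b
   with no common fixed point, a component that contains a fixed point of a or
   b contains exactly two; this is what makes the product of two diagrams a
   diagram. *)
Section TwoInvolutions.

Variables (V : finType) (a b : V -> V).
Hypotheses (aK : involutive a) (bK : involutive b).

Definition dih_edge (a b : V -> V) : rel V :=
  [rel u v | (v == a u) || (v == b u)].
Let e := dih_edge a b.

Let p := a \o b.
Let p_inj : injective p.
Proof. by move=> u v /(inv_inj aK) /(inv_inj bK). Qed.

Lemma dih_sym : symmetric e.
Proof.
by move=> u v; rewrite /e /=; congr (_ || _); apply/eqP/eqP => ->;
  rewrite ?aK ?bK.
Qed.

Section Orbit.

Variable x : V.
Hypotheses (bx : b x = x) (ax : a x != x).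

Let L := order p x.

Let iterL : iter L p x = x. Proof. exact: iter_order. Qed.

Let L_gt1 : 1 < L.
Proof.
rewrite ltn_neqAle order_gt0 andbT; apply: contra_neq ax => L1.
by have := iterL; rewrite -L1 /= /p /= bx.
Qed.

Let b_iter i : i <= L -> b (iter i p x) = iter (L - i) p x.
Proof.
move=> leiL; have pi_inj : injective (iter i p) by elim: (i) => //= j IHj u v /p_inj /IHj.
apply: pi_inj.
rewrite -iterD subnKC // iterL.
elim: i {leiL} => [|i IHi]; first exact: bx.
by rewrite iterSr (_ : p _ = b (iter i p x)) // /p /= bK aK.
Qed.

Let a_iter i : i <= L -> a (iter i p x) = iter (L - i).+1 p x.
Proof. by move=> leiL; rewrite iterS -b_iter // /p /= bK. Qed.

Let connectP' z : connect e x z -> exists2 i, i < L & z = iter i p x.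
Proof.
move=> exz; suffices pz : fconnect p x z.
  by exists (findex p x z); rewrite ?findex_max ?iter_findex.
have cl : closed e (fconnect p x).
  apply: intro_closed; first exact/sym_connect_sym/dih_sym.
  move=> u v euv pu; have [i ltiL Du] : exists2 i, i < L & u = iter i p x.
    by exists (findex p x u); rewrite ?findex_max ?iter_findex.
  case/orP: euv => /eqP ->; rewrite Du.
    by rewrite a_iter ?(ltnW ltiL) //; exact: fconnect_iter.
  by rewrite b_iter ?(ltnW ltiL) //; exact: fconnect_iter.
by have := closed_connect cl exz; rewrite [LHS]connect0 => /esym.
Qed.

Let iter_inj' i j : i < L -> j < L -> iter i p x = iter j p x -> i = j.
Proof.
move=> ltiL ltjL; rewrite -(nth_traject _ ltiL) -(nth_traject _ ltjL).
by move=> /eqP; rewrite nth_uniq ?size_traject ?(orbit_uniq p x) // => /eqP.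
Qed.

Let y := iter (uphalf L) p x.

Lemma dih_end : exists y, [/\ y != x, (a y == y) || (b y == y), connect e x y &
  forall z, connect e x z -> (a z == z) || (b z == z) -> z = x \/ z = y].
Proof.
have uL : 0 < uphalf L < L by have := L_gt1; lia.
exists y; split.
- apply/eqP=> uL0; suff: uphalf L = 0 by lia.
  by apply: (@iter_inj' _ 0) uL0; lia.
- rewrite /y a_iter ?b_iter; try lia.
  case: (boolP (odd L)) => oL.
    have -> : (L - uphalf L).+1 = uphalf L by lia.
    by rewrite eqxx.
  have -> : L - uphalf L = uphalf L by lia.
  by rewrite eqxx orbT.
- rewrite /y; elim: (uphalf L) => //= i /connect_trans; apply.
  apply: (@connect_trans _ _ (b (iter i p x))); apply: connect1;
  by rewrite /e /dih_edge /= ?/p /= eqxx ?orbT.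
- move=> z /connectP'[[|i] ltiL ->]; first by left.
  move=> H; right; rewrite /y; congr (iter _ p x).
  move: H; rewrite a_iter ?b_iter; try lia.
  case/orP=> /eqP; last by move/iter_inj'; lia.
  have [->|i0] := posnP i.
    rewrite subn1 prednK ?(ltnW L_gt1) // iterL /= /p /= bx => xax.
    by have := ax; rewrite -xax eqxx.
  by move/iter_inj'; lia.
Qed.

End Orbit.

Lemma fix_sum (c : V -> int) (K : pred V) :
    (forall u, (a u \in K) = (u \in K)) ->
    (forall u, a u != u -> c (a u) = - c u)%R ->
  (\sum_(u in K) c u = \sum_(u in K | a u == u) c u)%R.
Proof.
move=> clK cN; rewrite (bigID (fun u => a u == u)) /=.
set s := (X in (_ + X)%R); suffices -> : s = 0%R by rewrite addr0.
have : s = (- s)%R; last by lia.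
rewrite {1}/s (reindex_inj (inv_inj aK)) /= -sumrN; apply: eq_big => [u|u].
  by rewrite clK aK eq_sym.
by case/andP=> _; rewrite aK eq_sym => /cN.
Qed.

End TwoInvolutions.

(* (true, i) is the top dot i and (false, i) the bottom dot i. *)
Definition dot (N : nat) : Type := (bool * 'I_N)%type.
HB.instance Definition _ N := Finite.on (dot N).

(* A partition of the dots into pairs is encoded by the fixed-point free
   involution that exchanges the two members of each pair. *)
Definition is_diagram N (f : {ffun dot N -> dot N}) : bool :=
  [forall x, (f (f x) == x) && (f x != x)].

Record diagram N := Diagram {
  partner :> {ffun dot N -> dot N};
  partnerP : is_diagram partner }.

HB.instance Definition _ N := [isSub of diagram N for @partner N].
HB.instance Definition _ N := [Finite of diagram N by <:].

Definition propagating N (D : diagram N) (x : dot N) : bool := (D x).1 != x.1.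

Definition id_ffun N : {ffun dot N -> dot N} := [ffun x => (~~ x.1, x.2)].

Lemma id_subproof N : is_diagram (id_ffun N).
Proof.
by apply/forallP=> -[c i]; rewrite !ffunE /= negbK eqxx xpair_eqE eqb_negLR; case: c.
Qed.

Definition id_diagram N : diagram N := Diagram (id_subproof N).

(* Vertices of the picture of A on top of B: the layers Some true, None and
   Some false are the top dots of A, the bottom dots of A identified with the
   top dots of B, and the bottom dots of B. *)
Definition stack (N : nat) : Type := (option bool * 'I_N)%type.
HB.instance Definition _ N := Finite.on (stack N).

Definition upper N (x : dot N) : stack N := (if x.1 then Some true else None, x.2).
Definition lower N (x : dot N) : stack N := (if x.1 then None else Some false, x.2).
Definition outer N (x : dot N) : stack N := (Some x.1, x.2).

Arguments upper : simpl never.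
Arguments lower : simpl never.
Arguments outer : simpl never.

Definition stack_edge N (A B : diagram N) : rel (stack N) := [rel u v |
  [exists x, (u == upper x) && (v == upper (A x))] ||
  [exists x, (u == lower x) && (v == lower (B x))]].

(* Two dots of the product are paired when a curve of the stack joins them;
   dcomp_ffunP below shows that the default value x is never used. *)
Definition dcomp_ffun N (A B : diagram N) : {ffun dot N -> dot N} :=
  [ffun x => odflt x
     [pick y | (y != x) && connect (stack_edge A B) (outer x) (outer y)]].

(* A connected component of the stack is a closed curve exactly when it contains
   no vertex of the first and last layers. *)
Definition loops N (A B : diagram N) : nat :=
  n_comp (stack_edge A B)
    [pred v | [forall x, ~~ connect (stack_edge A B) (outer x) v]].

Section DiagramTheory.

Variable N : nat.
Implicit Types (A B C D : diagram N) (x y z : dot N).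

Lemma partnerK D : involutive D.
Proof. by move=> x; have /forallP/(_ x)/andP[/eqP] := partnerP D. Qed.

Lemma partner_neq D x : D x != x.
Proof. by have /forallP/(_ x)/andP[] := partnerP D. Qed.

Lemma upper_inj : injective (@upper N).
Proof. by move=> [[] i] [[] j] // [->]. Qed.

Lemma lower_inj : injective (@lower N).
Proof. by move=> [[] i] [[] j] // [->]. Qed.

Lemma outer_inj : injective (@outer N).
Proof. by move=> [c i] [d j] [-> ->]. Qed.

Lemma stack_edge_upper A B x : stack_edge A B (upper x) (upper (A x)).
Proof. by apply/orP; left; apply/existsP; exists x; rewrite !eqxx. Qed.

Lemma stack_edge_lower A B x : stack_edge A B (lower x) (lower (B x)).
Proof. by apply/orP; right; apply/existsP; exists x; rewrite !eqxx. Qed.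

Lemma stack_edgeP A B u v : stack_edge A B u v ->
  (exists x, u = upper x /\ v = upper (A x)) \/
  (exists x, u = lower x /\ v = lower (B x)).
Proof.
by case/orP=> /existsP[x /andP[/eqP-> /eqP->]]; [left | right]; exists x.
Qed.

Lemma stack_sym A B : connect_sym (stack_edge A B).
Proof.
apply: sym_connect_sym; apply: symmetric_from_pre => u v.
case/stack_edgeP=> -[x [-> ->]].
  by rewrite -{2}(partnerK A x) stack_edge_upper.
by rewrite -{2}(partnerK B x) stack_edge_lower.
Qed.

Definition stA A (v : stack N) : stack N :=
  match v with
  | (Some true, i) => upper (A (true, i))
  | (None, i) => upper (A (false, i))
  | (Some false, _) => v
  end.

Definition stB B (v : stack N) : stack N :=
  match v with
  | (Some true, _) => v
  | (None, i) => lower (B (true, i))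
  | (Some false, i) => lower (B (false, i))
  end.

Lemma stA_upper A x : stA A (upper x) = upper (A x).
Proof. by case: x => -[] i. Qed.

Lemma stB_lower B x : stB B (lower x) = lower (B x).
Proof. by case: x => -[] i. Qed.

Variant stA_spec : stack N -> Type :=
  | StAUpper x : stA_spec (upper x)
  | StABottom i : stA_spec (Some false, i).

Lemma stA_case v : stA_spec v.
Proof.
case: v => -[[]|] i; last exact: (StAUpper (false, i)).
  exact: (StAUpper (true, i)).
exact: StABottom.
Qed.

Variant stB_spec : stack N -> Type :=
  | StBLower x : stB_spec (lower x)
  | StBTop i : stB_spec (Some true, i).

Lemma stB_case v : stB_spec v.
Proof.
case: v => -[[]|] i; last exact: (StBLower (true, i)).
  exact: StBTop.
exact: (StBLower (false, i)).
Qed.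

Lemma stAK A : involutive (stA A).
Proof. by move=> v; case: (stA_case v) => // x; rewrite !stA_upper partnerK. Qed.

Lemma stBK B : involutive (stB B).
Proof. by move=> v; case: (stB_case v) => // x; rewrite !stB_lower partnerK. Qed.

Lemma stA_fix A v : (stA A v == v) = (v.1 == Some false).
Proof.
case: (stA_case v) => [x|i]; last by rewrite !eqxx.
by rewrite stA_upper (inj_eq upper_inj) (negPf (partner_neq _ _)); case: x => -[].
Qed.

Lemma stB_fix B v : (stB B v == v) = (v.1 == Some true).
Proof.
case: (stB_case v) => [x|i]; last by rewrite !eqxx.
by rewrite stB_lower (inj_eq lower_inj) (negPf (partner_neq _ _)); case: x => -[].
Qed.

Lemma stack_connectE A B :
  connect (stack_edge A B) =2 connect (dih_edge (stA A) (stB B)).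
Proof.
move=> u v; apply/idP/idP; apply: connect_sub => {u v} u v.
  case/stack_edgeP=> -[x [-> ->]]; apply/connect1/orP; [left | right].
    by rewrite stA_upper.
  by rewrite stB_lower.
case/orP=> /eqP ->.
  case: (stA_case u) => [x|i]; last exact: connect0.
  by rewrite stA_upper; apply/connect1/stack_edge_upper.
case: (stB_case u) => [x|i]; last exact: connect0.
by rewrite stB_lower; apply/connect1/stack_edge_lower.
Qed.

Lemma dihC (V : finType) (a b : V -> V) :
  connect (dih_edge a b) =2 connect (dih_edge b a).
Proof. by apply: eq_connect => u v; rewrite /dih_edge /= orbC. Qed.

Lemma stack_end A B x : exists y, [/\ y != x,
    connect (stack_edge A B) (outer x) (outer y) &
    forall z, connect (stack_edge A B) (outer x) (outer z) -> z = x \/ z = y].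
Proof.
have key u : ((stA A u == u) || (stB B u == u)) = (u \in codom (@outer N)).
  rewrite stA_fix stB_fix; apply/idP/idP => [|/codomP[[[] i] ->] //].
  by case: u => -[c|] i //= _; apply: (codom_f _ (c, i)).
have [u [neu fu cu Pu]] : exists u, [/\ u != outer x, u \in codom (@outer N),
    connect (stack_edge A B) (outer x) u & forall w,
    connect (stack_edge A B) (outer x) w -> w \in codom (@outer N) ->
    w = outer x \/ w = u].
  case: x => -[] i.
    have [//||u [u1 u2 u3 u4]] :=
        @dih_end _ _ _ (stAK A) (stBK B) (outer (true, i)).
      by rewrite stA_fix.
    exists u; split; rewrite ?stack_connectE -?key // => z.
    by rewrite stack_connectE -key; apply: u4.
  have [//||u [u1 u2 u3 u4]] :=
      @dih_end _ _ _ (stBK B) (stAK A) (outer (false, i)).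
    by rewrite stB_fix.
  exists u; split; rewrite ?stack_connectE 1?dihC -?key 1?orbC // => z.
  by rewrite stack_connectE dihC -key orbC; apply: u4.
case/codomP: fu => y Du; exists y; split.
- by apply: contra_neq neu => <-.
- by rewrite -Du.
- move=> z /Pu/(_ (codom_f _ _)); rewrite Du.
  by case=> /outer_inj; [left | right].
Qed.

Lemma dcomp_ffunP A B x y :
  reflect (y = dcomp_ffun A B x)
          ((y != x) && connect (stack_edge A B) (outer x) (outer y)).
Proof.
suff E : (y != x) && connect (stack_edge A B) (outer x) (outer y)
    <-> y = dcomp_ffun A B x.
  by apply: (iffP idP); case: E.
have [y0 [ney cy Py]] := stack_end A B x.
have Dy0 : dcomp_ffun A B x = y0.
  rewrite ffunE; case: pickP => [z /andP[nez /Py[] // zx]|/(_ y0)/=].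
    by rewrite zx eqxx in nez.
  by rewrite ney cy.
rewrite Dy0; split=> [/andP[ney' /Py[]//]|->]; last by rewrite ney.
by move=> yx; rewrite yx eqxx in ney'.
Qed.

Lemma dcomp_subproof A B : is_diagram (dcomp_ffun A B).
Proof.
apply/forallP=> x; have /dcomp_ffunP/andP[ne c] := erefl (dcomp_ffun A B x).
by rewrite ne andbT eq_sym; apply/eqP/dcomp_ffunP; rewrite eq_sym ne stack_sym.
Qed.

Definition dcomp A B : diagram N := Diagram (dcomp_subproof A B).

Lemma dcompP A B x y :
  reflect (y = dcomp A B x)
          ((y != x) && connect (stack_edge A B) (outer x) (outer y)).
Proof. exact: dcomp_ffunP. Qed.

Lemma dcomp_connect A B x :
  connect (stack_edge A B) (outer x) (outer (dcomp A B x)).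
Proof. by have /dcompP/andP[] := erefl (dcomp A B x). Qed.

Lemma dcomp_connectE A B x y :
  connect (stack_edge A B) (outer x) (outer y) -> y = x \/ y = dcomp A B x.
Proof.
by have [->|ne c] := eqVneq y x; [left | right; apply/dcompP; rewrite ne].
Qed.

End DiagramTheory.

(* Contracting the part V1 of a graph on W to the pairing M of its boundary dots
   preserves connectedness, and deletes exactly the components of V1 that do
   not meet the boundary; used for the associativity of the product. *)
Section Gluing.

Variables (V1 V2 W D Q : finType).
Variables (e1 : rel V1) (e2 : rel V2) (g : rel W).
Variables (i1 : V1 -> W) (i2 : V2 -> W) (o : D -> V1) (d : D -> V2).
Variables (M : D -> D) (q : Q -> V2) (h : rel V2).

Hypotheses (e1_sym : connect_sym e1) (e2_sym : connect_sym e2).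
Hypothesis g_sym : connect_sym g.
Hypotheses (i1_inj : injective i1) (i2_inj : injective i2).
Hypothesis i12 : forall w, (exists v, w = i1 v) \/ (exists v, w = i2 v).
Hypothesis i1_i2 : forall v1 v2, i1 v1 = i2 v2 ->
  exists x, v1 = o x /\ v2 = d x.
Hypothesis i_od : forall x, i1 (o x) = i2 (d x).
Hypothesis oM : forall x, connect e1 (o x) (o (M x)).
Hypothesis oM_uniq : forall x y, connect e1 (o x) (o y) -> y = x \/ y = M x.
Hypothesis e2P : forall u v, e2 u v ->
  (exists x, u = d x /\ v = d (M x)) \/ h u v.
Hypothesis e2M : forall x, e2 (d x) (d (M x)).
Hypothesis e2h : forall u v, h u v -> e2 u v.
Hypothesis gP : forall u v, g u v ->
  (exists u' v', [/\ u = i1 u', v = i1 v' & e1 u' v']) \/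
  (exists u' v', [/\ u = i2 u', v = i2 v' & h u' v']).
Hypothesis g1 : forall u v, e1 u v -> g (i1 u) (i1 v).
Hypothesis g2 : forall u v, h u v -> g (i2 u) (i2 v).

Let closedP (P : W -> Prop) :
  (forall u v, g u v -> P u -> P v) -> forall u v, connect g u v -> P u -> P v.
Proof.
move=> clP u v /connectP[s gs ->]; elim: s u gs => //= w s IHs u /andP[guw gs].
by move=> Pu; apply: IHs gs _; apply: clP guw Pu.
Qed.

Lemma glue1 u v : connect e1 u v -> connect g (i1 u) (i1 v).
Proof.
case/connectP=> s e1s ->; elim: s u e1s => //= w s IHs u /andP[euw e1s].
by apply: connect_trans (IHs _ e1s); apply/connect1/g1.
Qed.

Lemma glue2 u v : connect e2 u v = connect g (i2 u) (i2 v).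
Proof.
apply/idP/idP.
  case/connectP=> s e2s ->; elim: s u e2s => //= w s IHs u /andP[euw e2s].
  apply: connect_trans (IHs _ e2s); case/e2P: euw => [[x [-> ->]]|/g2/connect1//].
  by rewrite -!i_od; apply: glue1.
have eqd x y : connect e1 (o x) (o y) -> connect e2 (d x) (d y).
  by case/oM_uniq=> ->; rewrite ?connect0 ?connect1.
pose P w := (exists v', w = i2 v' /\ connect e2 u v') \/
  (exists v1 x, [/\ w = i1 v1, connect e1 (o x) v1 & connect e2 u (d x)]).
have P2 w : P w -> forall v', w = i2 v' -> connect e2 u v'.
  case=> [[v' [-> cv']]|[v1 [x [-> c1 c2]]]] w' Dw'.
    by move/i2_inj: Dw' => <-.
  have [y [Dv1 ->]] := i1_i2 Dw'.
  by apply: connect_trans c2 (eqd _ _ _); rewrite -Dv1.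
have clP w w' : g w w' -> P w -> P w'.
  case/gP=> [[v1 [v1' [-> -> ev]]]|[v2 [v2' [-> -> hv]]]] Pw; last first.
    left; exists v2'; split=> //.
    exact: connect_trans (P2 _ Pw _ erefl) (connect1 (e2h hv)).
  right; exists v1'; case: Pw => [[v' [/i1_i2[x [Dv1 Dv']] cv']]|].
    by rewrite Dv1 Dv' in ev cv' *; exists x; split=> //; apply: connect1.
  case=> [v3 [x [/i1_inj <- c1 c2]]]; exists x; split=> //.
  exact: connect_trans c1 (connect1 ev).
move=> cg; suff Pv : P (i2 v) by apply: P2 Pv _ erefl.
by apply: closedP clP _ _ cg _; left; exists u.
Qed.

Let inner := [pred w | [forall x, ~~ connect g (i2 (q x)) w]].
Let touch := [pred w | [exists v, connect g (i2 v) w]].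

Let cl_inner : closed g inner.
Proof.
apply: (intro_closed g_sym) => u v guv /forallP inu; apply/forallP=> x.
apply: contra (inu x) => /connect_trans; apply; rewrite g_sym; exact: connect1.
Qed.

Let cl_touch : closed g touch.
Proof.
apply: (intro_closed g_sym) => u v guv /existsP[x cx]; apply/existsP; exists x.
exact: connect_trans cx (connect1 guv).
Qed.

Let A1 := [predD inner & touch].
Let A2 := [predI inner & touch].

Let cl1 : closed g A1.
Proof.
by move=> u v guv; move: (cl_inner guv) (cl_touch guv); rewrite !inE => -> ->.
Qed.

Let cl2 : closed g A2.
Proof.
by move=> u v guv; move: (cl_inner guv) (cl_touch guv); rewrite !inE => -> ->.
Qed.

Let A1_i1 w : w \in A1 -> exists v, w = i1 v.
Proof.
case/andP=> /existsP nt _; case: (i12 w) => // -[v Dw]; case: nt.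
by exists v; rewrite Dw connect0.
Qed.

Lemma glue_count :
  n_comp g [pred w | [forall x, ~~ connect g (i2 (q x)) w]] =
    n_comp e1 [pred v | [forall x, ~~ connect e1 (o x) v]] +
    n_comp e2 [pred v | [forall x, ~~ connect e2 (q x) v]].
Proof.
have -> : n_comp g inner = n_comp g A1 + n_comp g A2.
  rewrite /n_comp_mem -(cardID (mem touch)) addnC; congr (_ + _).
    apply: eq_card => w; apply/andP/andP=> -[Pw1 /andP[Pw2 Pw3]];
    by split=> //; apply/andP.
  apply: eq_card => w.
  apply/andP/andP=> [[/andP[Pw1 Pw2] Pw3]|[Pw1 /andP[Pw2 Pw3]]];
  by split=> //; apply/andP.
congr (_ + _).
  rewrite (@adjunction_n_comp _ _ i1 g e1) //; last first.
    split=> [w A1w|u v A1u].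
      have ex : exists v, w == i1 v by have [v ->] := A1_i1 A1w; exists v.
      by exists (xchoose ex); rewrite -(eqP (xchooseP ex)).
    apply/idP/idP=> [/glue1 //|cg].
    pose P w := w \in A1 /\ exists2 v', w = i1 v' & connect e1 u v'.
    suff [] : P (i1 v) by move=> _ [v' /i1_inj <-].
    apply: closedP cg _; last by split=> //; exists u.
    move=> w w' gw [A1w [u' Dw cu]]; split; first by rewrite -(cl1 gw).
    case/gP: (gw) => [[v1 [v1' [Dw1 -> ev]]]|[v2 [v2' [Dw2 _ _]]]].
      exists v1' => //; apply: connect_trans cu (connect1 _).
      by rewrite Dw in Dw1; rewrite (i1_inj Dw1).
    by case/andP: A1w => /existsP[]; exists v2; rewrite Dw2 connect0.
  apply: eq_n_comp_r => v; rewrite !inE.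
  apply/andP/forallP => [[/existsP nt _] x|nt].
    apply/negP=> /glue1 cg; apply: nt; exists (d x).
    by rewrite -i_od.
  suff ntv : i1 v \notin touch.
    split=> //; apply/forallP=> x; apply: contra ntv => cx.
    by apply/existsP; exists (q x).
  apply/existsP=> -[v2]; rewrite g_sym => cg.
  pose P w := exists2 v', w = i1 v' & connect e1 v v'.
  have P0 w v' : P w -> w = i2 v' -> False.
    move=> [v1 -> c1] /i1_i2[x [Dv1 _]]; have /negP[] := nt x.
    by rewrite e1_sym -Dv1.
  have clP w w' : g w w' -> P w -> P w'.
    move=> gw Pw; case/gP: gw => [[v1 [v1' [Dw1 -> ev]]]|[v3 [v3' [Dw2 _ _]]]].
      exists v1' => //; case: Pw => v' Dw c; apply: connect_trans c (connect1 _).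
      by rewrite Dw in Dw1; rewrite (i1_inj Dw1).
    by case: (P0 _ _ Pw Dw2).
  by apply: (P0 (i2 v2) v2) => //; apply: closedP clP _ _ cg _; exists v.
rewrite (@adjunction_n_comp _ _ i2 g e2) //; last first.
  split=> [w /andP[_ tw]|u v _]; last exact: glue2.
  have ex : exists v, connect g (i2 v) w by apply/existsP.
  by exists (xchoose ex); rewrite g_sym (xchooseP ex).
apply: eq_n_comp_r => v; rewrite !inE; apply/andP/forallP => [[/forallP iv _] x|iv].
  by rewrite glue2.
split; last by apply/existsP; exists v.
by apply/forallP=> x; rewrite -glue2.
Qed.

End Gluing.

Lemma diagram_eq N (A B : diagram N) : A =1 B -> A = B.
Proof. by move=> eqAB; apply/val_inj/ffunP. Qed.

Section Associativity.

Variable N : nat.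
Implicit Types A B C : diagram N.

Let W : finType := ((bool * bool) * 'I_N)%type.

Let wA (x : dot N) : W := ((true, x.1), x.2).
Let wB (x : dot N) : W := (if x.1 then (true, false) else (false, true), x.2).
Let wC (x : dot N) : W := ((false, x.1), x.2).
Let wO (x : dot N) : W := ((x.1, x.1), x.2).

Definition stack3_edge A B C : rel W := [rel u v |
  [|| [exists x, (u == wA x) && (v == wA (A x))],
      [exists x, (u == wB x) && (v == wB (B x))] |
      [exists x, (u == wC x) && (v == wC (C x))]]].

Let stack3P A B C u v : stack3_edge A B C u v ->
  [\/ exists x, u = wA x /\ v = wA (A x),
      exists x, u = wB x /\ v = wB (B x) |
      exists x, u = wC x /\ v = wC (C x)].
Proof.
by case/or3P=> /existsP[x /andP[/eqP-> /eqP->]];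
  [constructor 1 | constructor 2 | constructor 3]; exists x.
Qed.

Let s3A A B C x : stack3_edge A B C (wA x) (wA (A x)).
Proof. by apply/or3P; constructor 1; apply/existsP; exists x; rewrite !eqxx. Qed.

Let s3B A B C x : stack3_edge A B C (wB x) (wB (B x)).
Proof. by apply/or3P; constructor 2; apply/existsP; exists x; rewrite !eqxx. Qed.

Let s3C A B C x : stack3_edge A B C (wC x) (wC (C x)).
Proof. by apply/or3P; constructor 3; apply/existsP; exists x; rewrite !eqxx. Qed.

Let stack3_sym A B C : connect_sym (stack3_edge A B C).
Proof.
apply: sym_connect_sym; apply: symmetric_from_pre => u v.
case/stack3P=> -[x [-> ->]].
- by rewrite -{2}(partnerK A x) s3A.
- by rewrite -{2}(partnerK B x) s3B.
- by rewrite -{2}(partnerK C x) s3C.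
Qed.

Let jAB (v : stack N) : W :=
  (match v.1 with Some true => (true, true) | None => (true, false)
                | Some false => (false, true) end, v.2).
Let jAB_C (v : stack N) : W :=
  (match v.1 with Some true => (true, true) | None => (false, true)
                | Some false => (false, false) end, v.2).
Let jBC (v : stack N) : W :=
  (match v.1 with Some true => (true, false) | None => (false, true)
                | Some false => (false, false) end, v.2).
Let jA_BC (v : stack N) : W :=
  (match v.1 with Some true => (true, true) | None => (true, false)
                | Some false => (false, false) end, v.2).

Let hC C : rel (stack N) :=
  [rel u v | [exists x, (u == lower x) && (v == lower (C x))]].
Let hA A : rel (stack N) :=
  [rel u v | [exists x, (u == upper x) && (v == upper (A x))]].

Let jinj : [/\ injective jAB, injective jAB_C, injective jBC & injective jA_BC].
Proof. by split=> -[[[]|] i] [[[]|] j] // [->]. Qed.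

Lemma glue_left A B C :
  (forall u v, connect (stack_edge (dcomp A B) C) u v =
    connect (stack3_edge A B C) (jAB_C u) (jAB_C v)) /\
  n_comp (stack3_edge A B C)
    [pred w | [forall x, ~~ connect (stack3_edge A B C) (wO x) w]] =
  loops A B + loops (dcomp A B) C.
Proof.
have [inj1 inj2 _ _] := jinj.
have i12 w : (exists v, w = jAB v) \/ (exists v, w = jAB_C v).
  case: w => [[[] []] i].
  - by left; exists (Some true, i).
  - by left; exists (None, i).
  - by left; exists (Some false, i).
  - by right; exists (Some false, i).
have i1_i2 v1 v2 : jAB v1 = jAB_C v2 -> exists x, v1 = outer x /\ v2 = upper x.
  case: v1 v2 => [[[]|] i] [[[]|] j] // [->].
    by exists (true, j).
  by exists (false, j).
have iod x : jAB (outer x) = jAB_C (upper x) by case: x => -[].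
have e2P u v : stack_edge (dcomp A B) C u v ->
    (exists x, u = upper x /\ v = upper (dcomp A B x)) \/ hC C u v.
  by case/orP=> [/existsP[x /andP[/eqP-> /eqP->]]|]; [left; exists x | right].
have e2h u v : hC C u v -> stack_edge (dcomp A B) C u v.
  by move=> huv; apply/orP; right.
have gP u v : stack3_edge A B C u v ->
  (exists u' v', [/\ u = jAB u', v = jAB v' & stack_edge A B u' v']) \/
  (exists u' v', [/\ u = jAB_C u', v = jAB_C v' & hC C u' v']).
  have jA x : wA x = jAB (upper x) by case: x => -[].
  have jB x : wB x = jAB (lower x) by case: x => -[].
  have jC x : wC x = jAB_C (lower x) by case: x => -[].
  case/stack3P=> -[x [-> ->]]; [left | left | right].
  - by exists (upper x), (upper (A x)); rewrite -!jA; split=> //; apply: stack_edge_upper.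
  - by exists (lower x), (lower (B x)); rewrite -!jB; split=> //; apply: stack_edge_lower.
  - exists (lower x), (lower (C x)); rewrite -!jC; split=> //.
    by apply/existsP; exists x; rewrite !eqxx.
have g1 u v : stack_edge A B u v -> stack3_edge A B C (jAB u) (jAB v).
  case/stack_edgeP=> -[x [-> ->]].
    by have := s3A A B C x; case: x (A x) => [[] i] [[] j].
  by have := s3B A B C x; case: x (B x) => [[] i] [[] j].
have g2 u v : hC C u v -> stack3_edge A B C (jAB_C u) (jAB_C v).
  case/existsP=> x /andP[/eqP-> /eqP->].
  by have := s3C A B C x; case: x (C x) => [[] i] [[] j].
split=> [u v|].
  by apply: (@glue2 _ _ _ _ _ _ _ jAB jAB_C _ _ (dcomp A B) _ inj1 inj2 i1_i2 iod
    (dcomp_connect A B) (@dcomp_connectE _ A B) e2P (stack_edge_upper _ _) e2h gP g1 g2).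
have <- := @glue_count _ _ _ _ _ _ _ _ jAB jAB_C _ _ (dcomp A B) (@outer N) _ (@stack_sym _ A B) (@stack_sym _ _ C) (@stack3_sym A B C)
   inj1 inj2 i12 i1_i2 iod
    (dcomp_connect A B) (@dcomp_connectE _ A B) e2P (stack_edge_upper _ _) e2h gP g1 g2.
apply: eq_n_comp_r => w; rewrite !inE; apply: eq_forallb => -[[] i];
by rewrite /wO /jAB_C.
Qed.

Lemma glue_right A B C :
  (forall u v, connect (stack_edge A (dcomp B C)) u v =
    connect (stack3_edge A B C) (jA_BC u) (jA_BC v)) /\
  n_comp (stack3_edge A B C)
    [pred w | [forall x, ~~ connect (stack3_edge A B C) (wO x) w]] =
  loops B C + loops A (dcomp B C).
Proof.
have [_ _ inj1 inj2] := jinj.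
have i12 w : (exists v, w = jBC v) \/ (exists v, w = jA_BC v).
  case: w => [[[] []] i].
  - by right; exists (Some true, i).
  - by left; exists (Some true, i).
  - by left; exists (None, i).
  - by left; exists (Some false, i).
have i1_i2 v1 v2 : jBC v1 = jA_BC v2 -> exists x, v1 = outer x /\ v2 = lower x.
  case: v1 v2 => [[[]|] i] [[[]|] j] // [->].
    by exists (true, j).
  by exists (false, j).
have iod x : jBC (outer x) = jA_BC (lower x) by case: x => -[].
have e2P u v : stack_edge A (dcomp B C) u v ->
    (exists x, u = lower x /\ v = lower (dcomp B C x)) \/ hA A u v.
  by case/orP=> [|/existsP[x /andP[/eqP-> /eqP->]]]; [right | left; exists x].
have e2h u v : hA A u v -> stack_edge A (dcomp B C) u v.
  by move=> huv; apply/orP; left.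
have gP u v : stack3_edge A B C u v ->
  (exists u' v', [/\ u = jBC u', v = jBC v' & stack_edge B C u' v']) \/
  (exists u' v', [/\ u = jA_BC u', v = jA_BC v' & hA A u' v']).
  have jA x : wA x = jA_BC (upper x) by case: x => -[].
  have jB x : wB x = jBC (upper x) by case: x => -[].
  have jC x : wC x = jBC (lower x) by case: x => -[].
  case/stack3P=> -[x [-> ->]]; [right | left | left].
  - exists (upper x), (upper (A x)); rewrite -!jA; split=> //.
    by apply/existsP; exists x; rewrite !eqxx.
  - by exists (upper x), (upper (B x)); rewrite -!jB; split=> //; apply: stack_edge_upper.
  - by exists (lower x), (lower (C x)); rewrite -!jC; split=> //; apply: stack_edge_lower.
have g1 u v : stack_edge B C u v -> stack3_edge A B C (jBC u) (jBC v).
  case/stack_edgeP=> -[x [-> ->]].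
    by have := s3B A B C x; case: x (B x) => [[] i] [[] j].
  by have := s3C A B C x; case: x (C x) => [[] i] [[] j].
have g2 u v : hA A u v -> stack3_edge A B C (jA_BC u) (jA_BC v).
  case/existsP=> x /andP[/eqP-> /eqP->].
  by have := s3A A B C x; case: x (A x) => [[] i] [[] j].
split=> [u v|].
  by apply: (@glue2 _ _ _ _ _ _ _ jBC jA_BC _ _ (dcomp B C) _ inj1 inj2 i1_i2 iod
    (dcomp_connect B C) (@dcomp_connectE _ B C) e2P (stack_edge_lower _ _) e2h gP g1 g2).
have <- := @glue_count _ _ _ _ _ _ _ _ jBC jA_BC _ _ (dcomp B C) (@outer N) _ (@stack_sym _ B C) (@stack_sym _ A _) (@stack3_sym A B C)
   inj1 inj2 i12 i1_i2 iod
    (dcomp_connect B C) (@dcomp_connectE _ B C) e2P (stack_edge_lower _ _) e2h gP g1 g2.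
apply: eq_n_comp_r => w; rewrite !inE; apply: eq_forallb => -[[] i];
by rewrite /wO /jA_BC.
Qed.

Lemma dcompA A B C : dcomp A (dcomp B C) = dcomp (dcomp A B) C.
Proof.
apply: diagram_eq => x; apply/dcompP.
have /dcompP/andP[-> /=] := erefl (dcomp A (dcomp B C) x).
rewrite (glue_right A B C).1 (glue_left A B C).1.
by case: x (dcomp A _ x) => [[] i] [[] j].
Qed.

Lemma loopsA A B C :
  loops A B + loops (dcomp A B) C = loops B C + loops A (dcomp B C).
Proof. by rewrite -(glue_left A B C).2 (glue_right A B C).2. Qed.

Lemma dcomp1d A : dcomp (id_diagram N) A = A.
Proof.
apply: diagram_eq => x; apply/esym/dcompP; rewrite partner_neq /=.
have E y : connect (stack_edge (id_diagram N) A) (outer y) (lower y).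
  case: y => -[] i; last exact: connect0.
  have := stack_edge_upper (id_diagram N) A (true, i).
  by rewrite ffunE => /connect1.
apply: connect_trans (E x) _; rewrite stack_sym.
apply: connect_trans (E (A x)) _; rewrite stack_sym.
exact/connect1/stack_edge_lower.
Qed.

Lemma dcompd1 A : dcomp A (id_diagram N) = A.
Proof.
apply: diagram_eq => x; apply/esym/dcompP; rewrite partner_neq /=.
have E y : connect (stack_edge A (id_diagram N)) (outer y) (upper y).
  case: y => -[] i; first exact: connect0.
  have := stack_edge_lower A (id_diagram N) (false, i).
  by rewrite ffunE => /connect1.
apply: connect_trans (E x) _; rewrite stack_sym.
apply: connect_trans (E (A x)) _; rewrite stack_sym.
exact/connect1/stack_edge_upper.
Qed.

Lemma loops_eq0 A B :
    (forall i, exists x, connect (stack_edge A B) (outer x) (None, i)) ->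
  loops A B = 0.
Proof.
move=> AB0; apply: eq_card0 => -[c i]; rewrite !inE.
apply/negbTE/negP => /andP[_ /forallP no].
case: c no => [c|] no.
  by have /negP[] := no (c, i); apply: connect0.
by have [x cx] := AB0 i; have /negP[] := no x.
Qed.

Lemma loops1d A : loops (id_diagram N) A = 0.
Proof.
apply: loops_eq0 => i; exists (true, i).
have := stack_edge_upper (id_diagram N) A (true, i).
by rewrite ffunE => /connect1.
Qed.

Lemma loopsd1 A : loops A (id_diagram N) = 0.
Proof.
apply: loops_eq0 => i; exists (false, i).
have := stack_edge_lower A (id_diagram N) (false, i).
by rewrite ffunE => /connect1.
Qed.

End Associativity.

Definition left_of N (r : nat) (x : dot N) : bool := x.2 < r.

Definition is_walled N (r : nat) (D : diagram N) : bool :=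
  [forall x, (left_of r (D x) != left_of r x) == ~~ propagating D x].

Record wdiagram (r s : nat) := WDiagram {
  wdiagram_val :> diagram (r + s);
  wdiagramP : is_walled r wdiagram_val }.

HB.instance Definition _ r s := [isSub of wdiagram r s for @wdiagram_val r s].
HB.instance Definition _ r s := [Finite of wdiagram r s by <:].

Section WalledTheory.

Variables (N r : nat).
Implicit Types (D A B : diagram N) (x y : dot N).

Definition orient x : bool := left_of r x == x.1.

Lemma walledP D : reflect (forall x, orient (D x) = ~~ orient x) (is_walled r D).
Proof.
apply: (iffP forallP) => wD x; move: (wD x); rewrite /orient /propagating /left_of;
by case: (D x).1 x.1 (_ < r) (_ < r) => [] [] [] [].
Qed.

Lemma id_walled : is_walled r (id_diagram N).
Proof.
by apply/walledP=> -[c i]; rewrite /orient /left_of ffunE /=; case: c (_ < r) => [] [].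
Qed.

Lemma dcomp_walled A B : is_walled r A -> is_walled r B -> is_walled r (dcomp A B).
Proof.
move=> /walledP wA /walledP wB; apply/walledP=> x; set y := dcomp A B x.
pose col (v : stack N) : int := (if (v.2 < r)%N (+) (v.1 == None) then 1 else -1)%R.
have colU z : (col (upper z) = if orient z then 1 else -1)%R.
  by case: z => -[] i; rewrite /col /orient /left_of /=; case: (i < r)%N.
have colL z : (col (lower z) = if orient z then -1 else 1)%R.
  by case: z => -[] i; rewrite /col /orient /left_of /=; case: (i < r)%N.
set e := stack_edge A B; pose K := connect e (outer x).
have e_cl u v : connect e u v -> (v \in K) = (u \in K).
  by move=> cuv; rewrite -!topredE /= /K !(stack_sym A B (outer x)) -(same_connect (@stack_sym _ A B) cuv).
have KA u : (stA A u \in K) = (u \in K).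
  by apply: e_cl; rewrite /e stack_connectE; apply/connect1/orP; left.
have KB u : (stB B u \in K) = (u \in K).
  by apply: e_cl; rewrite /e stack_connectE; apply/connect1/orP; right.
have sA : (\sum_(u in K) col u = \sum_(u in K | u.1 == Some false) col u)%R.
  rewrite (fix_sum (@stAK _ A) KA) => [|u]; first by apply: eq_bigl => u; rewrite stA_fix.
  case: (stA_case u) => [z|i]; last by rewrite eqxx.
  by rewrite stA_upper !colU wA; case: (orient z).
have sB : (\sum_(u in K) col u = \sum_(u in K | u.1 == Some true) col u)%R.
  rewrite (fix_sum (@stBK _ B) KB) => [|u]; first by apply: eq_bigl => u; rewrite stB_fix.
  case: (stB_case u) => [z|i]; last by rewrite eqxx.
  by rewrite stB_lower !colL wB; case: (orient z).
have /dcompP/andP[ne cxy] := erefl y.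
have S c : (\sum_(u in K | u.1 == Some c) col u =
    \sum_(u <- [seq u <- [:: outer x; outer y] | u.1 == Some c]) col u)%R.
  rewrite big_uniq; last first.
    by rewrite filter_uniq //= inE (inj_eq (@outer_inj N)) eq_sym ne.
  apply: eq_bigl => u; rewrite mem_filter andbC !inE.
  case: u => -[d|] i //=; case: eqP => //= -[->].
  rewrite -[(Some c, i)]/(outer (c, i)) !(inj_eq (@outer_inj N)).
  apply/idP/orP=> [|[/eqP->|/eqP->]]; last 2 first.
  - exact: connect0.
  - exact: cxy.
  by case/dcomp_connectE=> ->; [left | right].
have := sA; rewrite sB !S /= /outer /orient /left_of /=.
case: (x) (y) => [[] i] [[] j] /=; rewrite ?big_cons ?big_nil /col /=;
by do 2!case: (_ < r)%N.
Qed.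

End WalledTheory.

(* slot identifies the positions 1..r+n | 1..s+m with the disjoint union of the
   outer ones (the first r and the last s) and of the n + m ones next to the
   wall. On the right of the wall the m inner positions come first, whence the
   cast from 'I_(s + m) to 'I_(m + s). *)
Section Placement.

Variables r s n m : nat.

Definition slot (p : 'I_((r + n) + (s + m))) : 'I_(r + s) + 'I_(n + m) :=
  match split p with
  | inl l => match split l with
             | inl i => inl (lshift s i)
             | inr j => inr (lshift m j)
             end
  | inr q => match split (cast_ord (addnC s m) q) with
             | inl j => inr (rshift n j)
             | inr i => inl (rshift r i)
             end
  end.

Definition unslot (q : 'I_(r + s) + 'I_(n + m)) : 'I_((r + n) + (s + m)) :=
  match q with
  | inl i => match split i with
             | inl i1 => lshift (s + m) (lshift n i1)
             | inr i2 => rshift (r + n) (cast_ord (addnC m s) (rshift m i2))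
             end
  | inr j => match split j with
             | inl j1 => lshift (s + m) (rshift r j1)
             | inr j2 => rshift (r + n) (cast_ord (addnC m s) (lshift s j2))
             end
  end.

Lemma unslotK : cancel unslot slot.
Proof.
case=> i; rewrite /unslot; case: split_ordP => j ->; rewrite /slot.
- by rewrite -[lshift _ _]/(unsplit (inl _)) unsplitK
    -[lshift _ _]/(unsplit (inl _)) unsplitK.
- by rewrite -[rshift _ _]/(unsplit (inr _)) unsplitK cast_ord_comp cast_ord_id
    -[rshift _ _]/(unsplit (inr _)) unsplitK.
- by rewrite -[lshift _ _]/(unsplit (inl _)) unsplitK
    -[rshift _ _]/(unsplit (inr _)) unsplitK.
by rewrite -[rshift _ _]/(unsplit (inr _)) unsplitK cast_ord_comp cast_ord_id
    -[lshift _ _]/(unsplit (inl _)) unsplitK.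
Qed.

Lemma slotK : cancel slot unslot.
Proof.
move=> p; rewrite /slot; case: split_ordP => l -> /=.
  by case: split_ordP => j -> /=;
    rewrite -?[lshift _ j]/(unsplit (inl j)) -?[rshift _ j]/(unsplit (inr j)) unsplitK.
case: split_ordP => j Dj /=;
  rewrite -?[lshift _ j]/(unsplit (inl j)) -?[rshift _ j]/(unsplit (inr j)) unsplitK;
by rewrite -Dj; congr rshift; apply: val_inj.
Qed.

Lemma unslot_left q :
  (unslot q < r + n) = match q with inl i => i < r | inr j => j < n end.
Proof.
by case: q => i; rewrite /unslot; case: (split_ordP i) => j _ /=; have := ltn_ord j; lia.
Qed.

Arguments slot : simpl never.
Arguments unslot : simpl never.

Definition dmerge_ffun (D : diagram (r + s)) (E : diagram (n + m)) :
    {ffun dot ((r + n) + (s + m)) -> dot ((r + n) + (s + m))} :=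
  [ffun x => match slot x.2 with
             | inl i => let y := D (x.1, i) in (y.1, unslot (inl y.2))
             | inr j => let y := E (x.1, j) in (y.1, unslot (inr y.2))
             end].

Lemma dmerge_subproof D E : is_diagram (dmerge_ffun D E).
Proof.
apply/forallP=> -[c p]; rewrite !ffunE /=.
case Dp: (slot p) => [i|i] /=; rewrite unslotK /= -surjective_pairing partnerK /=;
rewrite -Dp slotK eqxx /=; apply/eqP=> -[Dc /(canRL unslotK)]; rewrite Dp => -[Di].
  by have := partner_neq D (c, i); rewrite (surjective_pairing (D _)) Dc Di eqxx.
by have := partner_neq E (c, i); rewrite (surjective_pairing (E _)) Dc Di eqxx.
Qed.

(* D on the outer positions, E on the middle ones. *)
Definition dmerge D E : diagram ((r + n) + (s + m)) := Diagram (dmerge_subproof D E).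

Lemma dmerge_walled D E :
  is_walled r D -> is_walled n E -> is_walled (r + n) (dmerge D E).
Proof.
move=> /walledP wD /walledP wE; apply/walledP=> -[c p].
rewrite /orient /left_of ffunE /=.
have -> : (p < r + n) = match slot p with inl i => i < r | inr j => j < n end.
  by rewrite -{1}(slotK p) unslot_left.
case: (slot p) => i; rewrite /= unslot_left.
  exact: (wD (c, i)).
exact: (wE (c, i)).
Qed.

End Placement.

Definition wiota r s n m (D : wdiagram r s) : wdiagram (r + n) (s + m) :=
  WDiagram (dmerge_walled (wdiagramP D) (id_walled (n + m) n)).

Definition wzeta r s n m (D : wdiagram r s) : wdiagram (n + r) (m + s) :=
  WDiagram (dmerge_walled (id_walled (n + m) n) (wdiagramP D)).

Local Open Scope ring_scope.

Section Bilinear.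

Variables (k : fieldType) (V : lmodType k) (I : finType) (e : I -> V).

Hypothesis e_span : forall v, exists c : I -> k, v = \sum_i c i *: e i.

Lemma linear_ext (U : lmodType k) (f g : V -> U) :
  linear f -> linear g -> (forall i, f (e i) = g (e i)) -> f =1 g.
Proof.
move=> lf lg fg v; have [c ->] := e_span v.
pose fL : {linear V -> U} := HB.pack f (GRing.isLinear.Build _ _ _ _ f lf).
pose gL : {linear V -> U} := HB.pack g (GRing.isLinear.Build _ _ _ _ g lg).
rewrite -[f]/(fL : V -> U) -[g]/(gL : V -> U) !linear_sum.
by apply: eq_bigr => i _; rewrite !linearZ /=; rewrite fg.
Qed.

Definition bilin (mul : V -> V -> V) :=
  (forall y, linear (mul^~ y)) /\ (forall x, linear (mul x)).

Variable mul : V -> V -> V.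
Hypothesis mulL : bilin mul.

Lemma bilin_assoc :
    (forall i j l, mul (e i) (mul (e j) (e l)) = mul (mul (e i) (e j)) (e l)) ->
  associative mul.
Proof.
case: mulL => mL mR eA x y z.
apply: (@linear_ext _ (fun x => mul x (mul y z)) (fun x => mul (mul x y) z)) x.
- exact: mL.
- by move=> a u v; rewrite mL mL.
move=> i; apply: (@linear_ext _ (fun y => mul _ (mul y z)) (fun y => mul (mul _ y) z)) y.
- by move=> a u v; rewrite mL mR.
- by move=> a u v; rewrite mR mL.
move=> j; apply: (@linear_ext _ (fun z => mul _ (mul _ z)) (fun z => mul (mul _ _) z)) z.
- by move=> a u v; rewrite mR mR.
- exact: mR.
by move=> l; apply: eA.
Qed.

Lemma bilin_1l u : (forall i, mul u (e i) = e i) -> left_id u mul.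
Proof. by case: mulL => mL mR; apply: linear_ext => // a x y. Qed.

Lemma bilin_1r u : (forall i, mul (e i) u = e i) -> right_id u mul.
Proof.
by case: mulL => mL mR ue x; apply: (@linear_ext _ (mul^~ u) id) x => // a x y.
Qed.

Lemma bilinDl : bilin mul -> left_distributive mul +%R.
Proof. by case=> mL _ x y z; have := mL z 1 x y; rewrite /= !scale1r. Qed.

Lemma bilinDr : bilin mul -> right_distributive mul +%R.
Proof. by case=> _ mR x y z; have := mR x 1 y z; rewrite /= !scale1r. Qed.

Lemma bilin0l x : mul 0 x = 0.
Proof. by case: mulL => mL _; have := mL x (-1) x x; rewrite scaleN1r addNr => ->; rewrite scaleN1r addNr. Qed.

Lemma bilin0r x : mul x 0 = 0.
Proof. by case: mulL => _ mR; have := mR x (-1) x x; rewrite scaleN1r addNr => ->; rewrite scaleN1r addNr. Qed.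

Lemma bilinZl a x y : a *: mul x y = mul (a *: x) y.
Proof. by case: mulL => mL _; have := mL y a x 0; rewrite /= bilin0l !addr0. Qed.

Lemma bilinZr a x y : a *: mul x y = mul x (a *: y).
Proof. by case: mulL => _ mR; have := mR x a y 0; rewrite /= bilin0r !addr0. Qed.

End Bilinear.

(* delta only matters for the ring structure defined below. *)
Definition brauer (k : fieldType) (delta : k) (N : nat) : Type :=
  {ffun diagram N -> k^o}.
HB.instance Definition _ k delta N := Vector.on (@brauer k delta N).

Definition bdiag (k : fieldType) (delta : k) N (A : diagram N) : brauer delta N :=
  [ffun C => (C == A)%:R].

Section Brauer.

Variables (k : fieldType) (delta : k) (N : nat).

Local Notation brauer := (brauer delta N).
Local Notation bdiag := (@bdiag k delta N).

Implicit Types (f g : brauer) (A B C : diagram N).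

Definition brauer_mul f g : brauer :=
  \sum_A \sum_B (f A * g B * delta ^+ loops A B) *: bdiag (dcomp A B).

Lemma brauerE f : f = \sum_A f A *: bdiag A.
Proof.
apply/ffunP=> C; rewrite sum_ffunE (bigD1 C) //= !ffunE eqxx.
rewrite big1 ?addr0 => [|A neA]; first by rewrite [LHS](esym (mulr1 _)).
by rewrite !ffunE eq_sym (negPf neA) scaler0.
Qed.

Lemma brauer_mul_bilin : bilin brauer_mul.
Proof.
split=> [g|f] a u v; rewrite /brauer_mul scaler_sumr -big_split; apply: eq_bigr => A _;
  rewrite scaler_sumr -big_split; apply: eq_bigr => B _;
  rewrite /= !ffunE scalerA -scalerDl; congr (_ *: _).
  by rewrite [a *: _]/(a * _) !mulrDl !mulrA.
by rewrite [a *: _]/(a * _) mulrDr mulrDl !mulrA [f A * a]mulrC.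
Qed.

Lemma brauer_mulE A B :
  brauer_mul (bdiag A) (bdiag B) = delta ^+ loops A B *: bdiag (dcomp A B).
Proof.
rewrite /brauer_mul (bigD1 A) //= [X in _ + X]big1 ?addr0 => [|A' neA]; last first.
  by apply: big1 => B' _; rewrite !ffunE (negPf neA) !mul0r scale0r.
rewrite (bigD1 B) //= [X in _ + X]big1 ?addr0 => [|B' neB]; last first.
  by rewrite !ffunE (negPf neB) mulr0 mul0r scale0r.
by rewrite !ffunE !eqxx !mul1r.
Qed.

Let span f : exists c : diagram N -> k, f = \sum_A c A *: bdiag A.
Proof. by exists f; apply: brauerE. Qed.

Let mulL := brauer_mul_bilin.

Lemma brauer_mulA : associative brauer_mul.
Proof.
apply: (bilin_assoc span mulL) => A B C.
rewrite !brauer_mulE -(bilinZr mulL) -(bilinZl mulL) !brauer_mulE !scalerA -!exprD.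
by rewrite dcompA loopsA.
Qed.

Lemma brauer_mul1l : left_id (bdiag (id_diagram N)) brauer_mul.
Proof.
by apply: (bilin_1l span mulL) => A; rewrite brauer_mulE dcomp1d loops1d scale1r.
Qed.

Lemma brauer_mul1r : right_id (bdiag (id_diagram N)) brauer_mul.
Proof.
by apply: (bilin_1r span mulL) => A; rewrite brauer_mulE dcompd1 loopsd1 scale1r.
Qed.

Lemma brauer_1neq0 : bdiag (id_diagram N) != 0.
Proof.
apply/eqP=> /ffunP/(_ (id_diagram N)); rewrite !ffunE eqxx => /eqP.
by rewrite oner_eq0.
Qed.

HB.instance Definition _ := GRing.Zmodule_isNzRing.Build brauer
  brauer_mulA brauer_mul1l brauer_mul1r (bilinDl mulL) (bilinDr mulL) brauer_1neq0.
HB.instance Definition _ :=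
  GRing.Lmodule_isLalgebra.Build k brauer (fun a x y => bilinZl mulL a x y).
HB.instance Definition _ :=
  GRing.Lalgebra_isAlgebra.Build k brauer (fun a x y => bilinZr mulL a x y).
HB.instance Definition _ := Algebra_isFalgebra.Build k brauer.

Lemma bdiagM A B : bdiag A * bdiag B = delta ^+ loops A B *: bdiag (dcomp A B).
Proof. exact: brauer_mulE. Qed.

Lemma bdiag1 : bdiag (id_diagram N) = 1. Proof. by []. Qed.

End Brauer.

(* The tensor product of two finite-dimensional algebras, in coordinates: the
   matrix unit (i, j) stands for the tensor of the i-th and j-th basis vectors.
   tensor_universal and tensM characterise it independently of the bases. *)
Section Tensor.

Variables (k : fieldType) (A B : falgType k).

Definition tensor : Type := 'M[k]_(\dim {: A}, \dim {: B}).
HB.instance Definition _ := Vector.on tensor.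

Definition tens (a : A) (b : B) : tensor :=
  \matrix_(i, j) (coord (vbasis {: A}) i a * coord (vbasis {: B}) j b).

Let eA (i : 'I_(\dim {: A})) : A := (vbasis {: A})`_i.
Let eB (i : 'I_(\dim {: B})) : B := (vbasis {: B})`_i.

Definition tens_mul (x y : tensor) : tensor :=
  \sum_i \sum_j \sum_i' \sum_j'
    (x i j * y i' j') *: tens (eA i * eA i') (eB j * eB j').

Lemma tens_linearl b : linear (tens^~ b).
Proof.
by move=> a u v; apply/matrixP=> i j; rewrite !mxE linearP mulrDl mulrA.
Qed.

Lemma tens_linearr a : linear (tens a).
Proof.
by move=> c u v; apply/matrixP=> i j; rewrite !mxE linearP mulrDr mulrCA.
Qed.

Lemma tens_basis i j : tens (eA i) (eB j) = delta_mx i j.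
Proof.
apply/matrixP=> i' j'; rewrite !mxE !(coord_free _ _ (basis_free (vbasisP _))).
by rewrite -natrM mulnb (eq_sym i) (eq_sym j).
Qed.

Lemma tensorE (x : tensor) : x = \sum_i \sum_j x i j *: tens (eA i) (eB j).
Proof.
rewrite {1}[x]matrix_sum_delta; apply: eq_bigr => i _; apply: eq_bigr => j _.
by rewrite tens_basis.
Qed.

Let e (u : 'I_(\dim {: A}) * 'I_(\dim {: B})) : tensor := tens (eA u.1) (eB u.2).

Let span (x : tensor) : exists c, x = \sum_u c u *: e u.
Proof.
by exists (fun u => x u.1 u.2); rewrite {1}[x]tensorE pair_bigA.
Qed.

Lemma tens_mul_bilin : bilin tens_mul.
Proof.
by split=> [y|x] a u v; rewrite /tens_mul; do 4!(rewrite scaler_sumr -big_split;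
  apply: eq_bigr => ? _); rewrite /= !mxE scalerA -scalerDl; congr (_ *: _);
  rewrite ?mulrDl ?mulrDr mulrA // mulrCA mulrA.
Qed.

Let mulL := tens_mul_bilin.

Let coordA (a : A) : a = \sum_i coord (vbasis {: A}) i a *: eA i.
Proof. exact: coord_vbasis (memvf a). Qed.

Let coordB (b : B) : b = \sum_i coord (vbasis {: B}) i b *: eB i.
Proof. exact: coord_vbasis (memvf b). Qed.

Lemma tens_mulE a b a' b' :
  tens_mul (tens a b) (tens a' b') = tens (a * a') (b * b').
Proof.
have sA x : exists c : 'I_(\dim {: A}) -> k, x = \sum_i c i *: eA i by eexists; apply: coordA.
have sB x : exists c : 'I_(\dim {: B}) -> k, x = \sum_i c i *: eB i by eexists; apply: coordB.
case: mulL => mL mR.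
apply: (linear_ext sA (f := fun a => tens_mul (tens a b) (tens a' b'))
                      (g := fun a => tens (a * a') (b * b'))) a.
- by move=> c u v; rewrite tens_linearl mL.
- by move=> c u v; rewrite mulrDl -scalerAl tens_linearl.
move=> i; apply: (linear_ext sB (f := fun b => tens_mul (tens _ b) (tens a' b'))
                      (g := fun b => tens (_ * a') (b * b'))) b.
- by move=> c u v; rewrite tens_linearr mL.
- by move=> c u v; rewrite mulrDl -scalerAl tens_linearr.
move=> j; apply: (linear_ext sA (f := fun a' => tens_mul (tens _ _) (tens a' b'))
                      (g := fun a' => tens (_ * a') (_ * b'))) a'.
- by move=> c u v; rewrite tens_linearl mR.
- by move=> c u v; rewrite mulrDr -scalerAr tens_linearl.
move=> i'; apply: (linear_ext sB (f := fun b' => tens_mul (tens _ _) (tens _ b'))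
                      (g := fun b' => tens _ (_ * b'))) b'.
- by move=> c u v; rewrite tens_linearr mR.
- by move=> c u v; rewrite mulrDr -scalerAr tens_linearr.
move=> j'; rewrite /tens_mul !tens_basis.
rewrite (bigD1 i) //= [X in _ + X]big1 ?addr0 => [|x nex]; last first.
  by do 3!(apply: big1 => ? _); rewrite !mxE (negPf nex) mul0r scale0r.
rewrite (bigD1 j) //= [X in _ + X]big1 ?addr0 => [|x nex]; last first.
  by do 2!(apply: big1 => ? _); rewrite !mxE (negPf nex) andbF mul0r scale0r.
rewrite (bigD1 i') //= [X in _ + X]big1 ?addr0 => [|x nex]; last first.
  by apply: big1 => ? _; rewrite !mxE (negPf nex) mulr0 scale0r.
rewrite (bigD1 j') //= [X in _ + X]big1 ?addr0 => [|x nex]; last first.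
  by rewrite !mxE (negPf nex) andbF mulr0 scale0r.
by rewrite !mxE !eqxx mulr1 scale1r.
Qed.

Lemma tens_mulA : associative tens_mul.
Proof. by apply: (bilin_assoc span mulL) => u v w; rewrite !tens_mulE !mulrA. Qed.

Lemma tens_mul1l : left_id (tens 1 1) tens_mul.
Proof. by apply: (bilin_1l span mulL) => u; rewrite tens_mulE !mul1r. Qed.

Lemma tens_mul1r : right_id (tens 1 1) tens_mul.
Proof. by apply: (bilin_1r span mulL) => u; rewrite tens_mulE !mulr1. Qed.

Lemma tens_1neq0 : tens 1 1 != 0.
Proof.
have nz (C : falgType k) : exists i, coord (vbasis {: C}) i (1 : C) != 0.
  apply/existsP; apply: contraNT (oner_neq0 C) => /existsPn C0.
  rewrite [1](coord_vbasis (memvf 1)) big1 // => i _.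
  by have /negPn/eqP-> := C0 i; rewrite scale0r.
have [i Ai] := nz A; have [j Bj] := nz B.
apply/eqP=> /matrixP/(_ i j); rewrite !mxE => /eqP.
by rewrite mulf_eq0 (negPf Ai) (negPf Bj).
Qed.

HB.instance Definition _ := GRing.Zmodule_isNzRing.Build tensor
  tens_mulA tens_mul1l tens_mul1r (bilinDl mulL) (bilinDr mulL) tens_1neq0.
HB.instance Definition _ :=
  GRing.Lmodule_isLalgebra.Build k tensor (fun a x y => bilinZl mulL a x y).
HB.instance Definition _ :=
  GRing.Lalgebra_isAlgebra.Build k tensor (fun a x y => bilinZr mulL a x y).
HB.instance Definition _ := Algebra_isFalgebra.Build k tensor.

Lemma tensM a b a' b' : tens a b * tens a' b' = tens (a * a') (b * b').
Proof. exact: tens_mulE. Qed.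

Lemma tens1 : tens 1 1 = 1. Proof. by []. Qed.

Lemma tensor_universal (W : lmodType k) (f : A -> B -> W) :
    (forall b, linear (f^~ b)) -> (forall a, linear (f a)) ->
  exists g : tensor -> W, [/\ linear g, forall a b, g (tens a b) = f a b &
    forall h : tensor -> W,
      linear h -> (forall a b, h (tens a b) = f a b) -> h =1 g].
Proof.
move=> fL fR.
have sA x : exists c : 'I_(\dim {: A}) -> k, x = \sum_i c i *: eA i by eexists; apply: coordA.
have sB x : exists c : 'I_(\dim {: B}) -> k, x = \sum_i c i *: eB i by eexists; apply: coordB.
pose g (x : tensor) := \sum_i \sum_j x i j *: f (eA i) (eB j).
have gL : linear g.
  move=> a u v; rewrite /g; do 2!(rewrite scaler_sumr -big_split; apply: eq_bigr => ? _).
  by rewrite /= !mxE scalerA -scalerDl.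
have gE a b : g (tens a b) = f a b.
  apply: (linear_ext sA (f := fun a => g (tens a b)) (g := f^~ b)) a => //.
    by move=> c u v; rewrite tens_linearl gL.
  move=> i; apply: (linear_ext sB (f := fun b => g (tens _ b))) b => //.
    by move=> c u v; rewrite tens_linearr gL.
  move=> j; rewrite /g tens_basis.
  rewrite (bigD1 i) //= [X in _ + X]big1 ?addr0 => [|x nex]; last first.
    by apply: big1 => ? _; rewrite !mxE (negPf nex) scale0r.
  rewrite (bigD1 j) //= [X in _ + X]big1 ?addr0 => [|x nex]; last first.
    by rewrite !mxE (negPf nex) andbF scale0r.
  by rewrite !mxE !eqxx scale1r.
exists g; split=> // h hL hE; apply: (linear_ext span) => // u.
by rewrite /e hE gE.
Qed.

End Tensor.

Section WalledBrauer.

Variables (k : fieldType) (delta : k) (r s : nat).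

Definition walled_span : {vspace brauer delta (r + s)} :=
  <<[seq bdiag delta D | D : wdiagram r s]>>%VS.

Lemma mem_walled_span (D : wdiagram r s) : bdiag delta D \in walled_span.
Proof. by apply: memv_span; apply: image_f. Qed.

Lemma walled_span1 : 1 \in walled_span.
Proof. exact: (mem_walled_span (WDiagram (id_walled (r + s) r))). Qed.

Lemma walled_span_is_aspace : is_aspace walled_span.
Proof.
rewrite /is_aspace has_algid1 ?walled_span1 //=.
apply/prodvP=> u v /(@coord_span _ _ _ (in_tuple _)) -> /(@coord_span _ _ _ (in_tuple _)) ->.
rewrite mulr_suml memv_suml // => i _; rewrite mulr_sumr memv_suml // => j _.
rewrite -scalerAl -scalerAr !memvZ //=.
have memP (l : 'I_(size [seq bdiag delta D | D : wdiagram r s])) :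
   exists D : wdiagram r s, [seq bdiag delta D | D : wdiagram r s]`_l = bdiag delta D.
  by have /imageP[D _ ->] := mem_nth 0 (ltn_ord l); exists D.
have [[D wD] ->] := memP i; have [[E wE] ->] := memP j.
rewrite bdiagM memvZ //.
exact: (mem_walled_span (WDiagram (dcomp_walled wD wE))).
Qed.

Canonical walled_aspace : {aspace brauer delta (r + s)} := ASpace walled_span_is_aspace.

Definition wBrauer : Type := subvs_of walled_aspace.
HB.instance Definition _ := Falgebra.on wBrauer.

Definition wbdiag (D : wdiagram r s) : wBrauer := Subvs (mem_walled_span D).

End WalledBrauer.

Definition boxtimes (k : fieldType) (delta : k) r s n m
    (D : wdiagram r s) (D' : wdiagram n m) : wBrauer delta (r + n) (s + m) :=
  wbdiag delta (wiota n m D) * wbdiag delta (wzeta r s D').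

Definition twisted_tensor (k : fieldType) (delta : k) r s n m :
    {vspace wBrauer delta (r + n) (s + m)} :=
  <<[seq boxtimes delta p.1 p.2 | p : (wdiagram r s * wdiagram n m)%type]>>%VS.

(* Main.v *)
Require Import Defs.
From HB Require Import structures.
From mathcomp Require Import all_boot all_algebra falgebra.

Set Implicit Arguments.
Unset Strict Implicit.
Unset Printing Implicit Defensive.

Import GRing.Theory.

(** Write D + E for the diagram [dmerge D E] that carries D on the outer
    positions and E on the positions next to the wall. The edges of D + E never
    join an outer position to an inner one, so the picture of D + E on top of
    D' + E' is the disjoint union of the picture of D on D' and that of E on E':
    the curves, closed or not, are those of the two parts. Hence
      (D + E) (D' + E') = (D D') + (E E'),
    with as many closed curves as the two parts have together ([dcomp_dmerge],
    [loops_dmerge]).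

    Both iota(D) = D + 1 and zeta(E) = 1 + E are sums of this kind. So iota and
    zeta extend to algebra morphisms ([wiota_ahom], [wzeta_ahom]), whose values
    commute, because iota(D) zeta(E) = D + E = zeta(E) iota(D) ([boxtimesE],
    [wzeta_iota]). By the universal property of the tensor product of algebras
    ([tensor_ahom]) they induce an algebra morphism f from the tensor product to
    the walled Brauer algebra, with f (D tensor E) = D + E. Its image is
    the twisted tensor product, which is therefore a unital subalgebra. Finally
    D and E can be read off from D + E ([wmerge_inj]) and the diagrams are
    linearly independent, so a linear map can send every D + E back to
    D tensor E. It is a left inverse of f, and f is an isomorphism onto its
    image ([ahom_corestrict]). *)

(** * Products of diagrams that restrict to a set of positions *)

(** This acts on dots and on vertices of a stack alike, so that it commutes
    with [upper], [lower] and [outer] by conversion. *)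
Definition place (T : Type) (a N : nat) (f : 'I_a -> 'I_N) (u : T * 'I_a) :
  T * 'I_N := (u.1, f u.2).

Arguments place : simpl never.
Arguments stA : simpl never.
Arguments stB : simpl never.

Section Block.

Variables (a N : nat) (f : 'I_a -> 'I_N).
Hypothesis f_inj : injective f.
Variables (A B : diagram N) (D E : diagram a).
Hypothesis AD : forall x, A (place f x) = place f (D x).
Hypothesis BE : forall x, B (place f x) = place f (E x).

Definition block : pred (stack N) := [pred w | w.2 \in codom f].

Lemma place_inj T : injective (@place T a N f).
Proof. by move=> [x i] [y j] [-> /f_inj->]. Qed.

Lemma place_block u : place f u \in block.
Proof. exact: codom_f. Qed.

Lemma blockP w : w \in block -> exists u, w = place f u.
Proof. by case: w => c p /codomP[i /= ->]; exists (c, i). Qed.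

(* Connectivity is studied in the graph of the two involutions: there the
   neighbours of a vertex are given by functions, which commute with place. *)
Let gE := stack_connectE A B.
Let eE := stack_connectE D E.
Let g := dih_edge (stA A) (stB B).
Let e := dih_edge (stA D) (stB E).

Let g_sym : connect_sym g.
Proof. exact/sym_connect_sym/dih_sym/stBK/stAK. Qed.

Let e_sym : connect_sym e.
Proof. exact/sym_connect_sym/dih_sym/stBK/stAK. Qed.

Lemma stA_place u : stA A (place f u) = place f (stA D u).
Proof.
by case: (stA_case u) => [x|i] //; rewrite -[place f (upper x)]/(upper (place f x))
  !stA_upper AD.
Qed.

Lemma stB_place u : stB B (place f u) = place f (stB E u).
Proof.
by case: (stB_case u) => [x|i] //; rewrite -[place f (lower x)]/(lower (place f x))
  !stB_lower BE.
Qed.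

Let g_place u v : g (place f u) (place f v) = e u v.
Proof.
by rewrite /g /e /dih_edge /= stA_place stB_place !(inj_eq (@place_inj _)).
Qed.

(** As A and B restrict to D and E, they pair the dots placed by f among
    themselves, so no edge of the stack leaves the block. *)
Let block_closed : closed g block.
Proof.
apply: (intro_closed g_sym) => u v guv /blockP[u' Du]; move: guv; rewrite Du.
by case/orP=> /eqP->; rewrite ?stA_place ?stB_place place_block.
Qed.

(** This is the form in which [adjunction_n_comp] can count the components of a
    union b of components of the block in the small stack. *)
Let block_adj (b : {pred stack N}) :
  {subset b <= block} -> closed g b -> rel_adjunction (place f) g e b.
Proof.
move=> sub cl; apply: strict_adjunction => //.
  exact: place_inj.
by apply/subsetP=> w /sub/blockP[u ->]; apply: codom_f.
Qed.

Lemma stack_connect_place u v :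
  connect (stack_edge A B) (place f u) (place f v) = connect (stack_edge D E) u v.
Proof.
rewrite gE eE; have [_ ->] // := block_adj (fun _ => id) block_closed.
exact: place_block.
Qed.

Lemma dcomp_place x : dcomp A B (place f x) = place f (dcomp D E x).
Proof.
apply/esym/dcompP; rewrite (inj_eq (@place_inj _)).
rewrite -[outer (place f x)]/(place f (outer x)).
rewrite -[outer (place f _)]/(place f (outer (dcomp D E x))).
by rewrite stack_connect_place; apply/dcompP.
Qed.

(** The small stack is a union of components of the large one, and a component
    in the block meets the first or last layer at dots of the block only. *)
Lemma loops_place :
  n_comp (stack_edge A B) [predI
    [pred v | [forall x, ~~ connect (stack_edge A B) (outer x) v]] & block] =
  loops D E.
Proof.
set inner := [pred v | _].
have cl : closed g [predI inner & block].
  move=> u v guv; congr (_ && _); last exact: block_closed guv.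
  apply: eq_forallb => x; congr (~~ _); rewrite !gE !(g_sym (outer x)).
  exact: same_connect (connect1 guv) _.
rewrite /loops (eq_n_comp gE) (eq_n_comp eE).
rewrite (adjunction_n_comp _ g_sym e_sym cl (block_adj _ cl)); last first.
  by move=> w /andP[].
apply: eq_n_comp_r => v; rewrite !inE [(place f v).2 \in _]place_block andbT.
apply/forallP/forallP=> [inn x|inn x].
  by have := inn (place f x); rewrite -stack_connect_place.
apply/negP=> c; have : outer x \in block.
  by rewrite (closed_connect block_closed (y := place f v)) ?place_block // -gE.
case/codomP=> i Dx; have /negP[] := inn (x.1, i).
by rewrite -stack_connect_place; move: c; case: x Dx => d j /= ->.
Qed.

End Block.

(** * Products of merged diagrams *)

Section Merge.

Variables r s n m : nat.

Definition outer_pos (i : 'I_(r + s)) : 'I_((r + n) + (s + m)) := unslot (inl i).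
Definition inner_pos (j : 'I_(n + m)) : 'I_((r + n) + (s + m)) := unslot (inr j).

Lemma outer_pos_inj : injective outer_pos.
Proof. by move=> i j /(can_inj (@unslotK _ _ _ _)) []. Qed.

Lemma inner_pos_inj : injective inner_pos.
Proof. by move=> i j /(can_inj (@unslotK _ _ _ _)) []. Qed.

Variant pos_spec : 'I_((r + n) + (s + m)) -> Type :=
  | PosOuter i : pos_spec (outer_pos i)
  | PosInner j : pos_spec (inner_pos j).

Lemma posP p : pos_spec p.
Proof. by rewrite -(slotK p); case: (slot p) => i; constructor. Qed.

Lemma inner_pos_outer p : (p \in codom inner_pos) = (p \notin codom outer_pos).
Proof.
case/posP: p => i; rewrite codom_f /=.
  by apply/negP=> /codomP[j /(can_inj (@unslotK _ _ _ _))].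
by apply/esym/negP=> /codomP[j /(can_inj (@unslotK _ _ _ _))].
Qed.

Implicit Types (D : diagram (r + s)) (E : diagram (n + m)).

Lemma dmerge_outer D E x : dmerge D E (place outer_pos x) = place outer_pos (D x).
Proof. by rewrite ffunE unslotK /= -surjective_pairing. Qed.

Lemma dmerge_inner D E x : dmerge D E (place inner_pos x) = place inner_pos (E x).
Proof. by rewrite ffunE unslotK /= -surjective_pairing. Qed.

Lemma dmerge_inj D E D' E' : dmerge D E = dmerge D' E' -> D = D' /\ E = E'.
Proof.
move=> eqDE; split; apply: diagram_eq => x.
  apply: (place_inj outer_pos_inj (T := bool)).
  by rewrite -(dmerge_outer D E) -(dmerge_outer D' E') eqDE.
apply: (place_inj inner_pos_inj (T := bool)).
by rewrite -(dmerge_inner D E) -(dmerge_inner D' E') eqDE.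
Qed.

Lemma dcomp_dmerge D E D' E' :
  dcomp (dmerge D E) (dmerge D' E') = dmerge (dcomp D D') (dcomp E E').
Proof.
apply: diagram_eq => -[c p]; case: (posP p) => i.
  rewrite -[(c, _)]/(place outer_pos (c, i)) dmerge_outer.
  by apply: dcomp_place; [apply: outer_pos_inj | apply: dmerge_outer..].
rewrite -[(c, _)]/(place inner_pos (c, i)) dmerge_inner.
by apply: dcomp_place; [apply: inner_pos_inj | apply: dmerge_inner..].
Qed.

(** A closed curve of the merged stack lies either in the outer block or in the
    inner one. *)
Lemma loops_dmerge D E D' E' :
  loops (dmerge D E) (dmerge D' E') = loops D D' + loops E E'.
Proof.
rewrite -(loops_place outer_pos_inj (dmerge_outer D E) (dmerge_outer D' E')).
rewrite -(loops_place inner_pos_inj (dmerge_inner D E) (dmerge_inner D' E')).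
rewrite /loops /n_comp_mem -(cardID (block outer_pos)); congr (_ + _).
  by apply: eq_card => w; rewrite !inE andbA.
by apply: eq_card => w; rewrite !inE inner_pos_outer andbC andbA.
Qed.

Lemma dmerge_id :
  dmerge (id_diagram (r + s)) (id_diagram (n + m)) = id_diagram ((r + n) + (s + m)).
Proof.
apply: diagram_eq => -[c p]; case: (posP p) => i; rewrite [RHS]ffunE.
  by rewrite -[(c, _)]/(place outer_pos (c, i)) dmerge_outer ffunE.
by rewrite -[(c, _)]/(place inner_pos (c, i)) dmerge_inner ffunE.
Qed.

End Merge.

(** * Algebra morphisms and tensor products *)

Local Open Scope ring_scope.

Lemma eq_on_span (k : fieldType) (V W : vectType k) (f g : 'Hom(V, W)) (X : seq V) :
  <<X>>%VS = fullv -> {in X, f =1 g} -> f =1 g.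
Proof.
move=> spX fg v; apply/eqlfunP/(subvP _ v (memvf v)); rewrite -spX.
by apply/span_subvP=> x /fg/eqlfunP.
Qed.

Lemma linear_lfun (k : fieldType) (V W : vectType k) (f : V -> W) :
  linear f -> exists F : 'Hom(V, W), F =1 f.
Proof.
move=> fL; pose l : {linear V -> W} := HB.pack f (GRing.isLinear.Build _ _ _ _ f fL).
by exists (linfun l) => v; rewrite lfunE.
Qed.

Lemma ahom_in_span (k : fieldType) (A C : falgType k) (f : 'Hom(A, C)) (X : seq A) :
    <<X>>%VS = fullv -> {in X &, {morph f : x y / x * y}} -> f 1 = 1 ->
  ahom_in fullv f.
Proof.
move=> spX fM f1; apply/ahom_inP; split=> // x y _ _.
have coordX z : z = \sum_i coord (in_tuple X) i z *: X`_i.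
  by apply: (coord_span (X := in_tuple X)); rewrite spX memvf.
rewrite (coordX x) (coordX y).
rewrite !mulr_suml ![f _]linear_sum mulr_suml; apply: eq_bigr => i _ /=.
rewrite !mulr_sumr linear_sum; apply: eq_bigr => j _ /=.
rewrite !linearZ -!scalerAr -!scalerAl 2!linearZ /=.
by rewrite fM ?mem_nth.
Qed.

Section Algebras.

Variables (k : fieldType) (A B C : falgType k).

Lemma tens_span (X : seq A) (Y : seq B) :
  <<X>>%VS = fullv -> <<Y>>%VS = fullv ->
  <<[seq tens a b | a <- X, b <- Y]>>%VS = fullv :> {vspace tensor A B}.
Proof.
move=> spX spY; apply/eqP; rewrite eqEsubv subvf; apply/subvP => x _.
have tens_mem a b : tens a b \in <<[seq tens a b | a <- X, b <- Y]>>%VS.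
  have [la laE] := linear_lfun (tens_linearl (A := A) b).
  rewrite -laE memv_preim; move: a (memvf a); rewrite -spX; apply/subvP.
  apply/span_subvP=> a Xa; rewrite -memv_preim laE.
  have [lb lbE] := linear_lfun (tens_linearr (B := B) a).
  rewrite -lbE memv_preim; move: b (memvf b) {la laE}; rewrite -spY => b Yb.
  apply: subvP Yb; apply/span_subvP=> b' Yb'; rewrite -memv_preim lbE.
  exact/memv_span/allpairs_f.
by rewrite [x]tensorE !memv_suml // => i _; rewrite memv_suml // => j _; rewrite memvZ.
Qed.

(** The universal property of the tensor product of algebras: commutation of the
    two images is what makes the induced linear map multiplicative. *)
Lemma tensor_ahom (phi : 'AHom(A, C)) (psi : 'AHom(B, C)) :
    (forall a b, phi a * psi b = psi b * phi a) ->
  exists f : 'AHom(tensor A B, C), forall a b, f (tens a b) = phi a * psi b.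
Proof.
move=> comm.
have [||g [gL gE _]] := @tensor_universal k A B C (fun a b => phi a * psi b).
- by move=> b c u v; rewrite linearP mulrDl scalerAl.
- by move=> a c u v; rewrite linearP mulrDr scalerAr.
have [gl glE] := linear_lfun gL.
suff gM : ahom_in fullv gl.
  by exists (AHom gM) => a b; rewrite /= glE gE.
apply: (ahom_in_span (tens_span (span_basis (vbasisP _)) (span_basis (vbasisP _)))).
  move=> _ _ /allpairsP[[a b] /= [_ _ ->]] /allpairsP[[a' b'] /= [_ _ ->]].
  by rewrite tensM !glE !gE !rmorphM /= -!mulrA; congr (_ * _); rewrite !mulrA comm.
by rewrite glE -tens1 gE !rmorph1 mulr1.
Qed.

End Algebras.

(** The identity of [subvs_of U] is [algid U], for a general U only an idempotent
    of C. *)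
Lemma vsval1 (k : fieldType) (C : falgType k) (U : {aspace C}) :
  1 \in U -> vsval (1 : subvs_of U) = 1.
Proof. by rewrite -algid_eq1 => /eqP. Qed.

Lemma ahom_corestrict (k : fieldType) (A C : falgType k) (f : 'AHom(A, C)) :
  injective f ->
  exists U : {aspace C}, [/\ U = limg f :> {vspace C}, 1 \in U &
    exists fU : 'AHom(A, subvs_of U), bijective fU].
Proof.
move=> f_inj.
have U1 : 1 \in limg f by rewrite -(rmorph1 f) memv_img ?memvf.
have asU : is_aspace (limg f).
  by rewrite /is_aspace has_algid1 // -aimgM limgS ?subvf.
exists (ASpace asU); split=> //.
set U := ASpace asU.
have fK x : vsval (vsproj U (f x)) = f x by rewrite vsprojK // memv_img ?memvf.
suff fM : ahom_in fullv (linfun (vsproj U) \o f)%VF.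
  exists (AHom fM); exists (f^-1 \o linfun vsval)%VF => x.
    by rewrite !lfunE /= !lfunE /= fK lker0_lfunK //; apply/lker0P.
  apply: val_inj; rewrite !lfunE /= !lfunE /= fK limg_lfunVK //.
  exact: (subvsP x).
apply/ahom_inP; split=> [x y _ _|]; apply: val_inj; rewrite /= !lfunE /= !lfunE /= !fK.
  by rewrite rmorphM.
by rewrite rmorph1 -[RHS]/(vsval (1 : subvs_of U)) vsval1.
Qed.

(** * Morphisms between walled Brauer algebras *)

Section Diagrams.

Variables (k : fieldType) (delta : k).

Section Extension.

Variables (r s : nat) (W : lmodType k) (h : wdiagram r s -> W).
Implicit Types D E : wdiagram r s.

(** The linear extension of a map given on walled diagrams, which form a basis;
    the coefficients at the other diagrams vanish. *)
Definition wextend (x : wBrauer delta r s) : W :=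
  \sum_(D : wdiagram r s) vsval x D *: h D.

Lemma wextend_linear : linear wextend.
Proof.
move=> a u v; rewrite /wextend scaler_sumr -big_split; apply: eq_bigr => D _ /=.
by rewrite !ffunE scalerA -scalerDl.
Qed.

Lemma wextendE D : wextend (wbdiag delta D) = h D.
Proof.
rewrite /wextend (bigD1 D) //= !ffunE eqxx scale1r big1 ?addr0 // => E neE.
by rewrite ffunE (inj_eq val_inj) (negPf neE) scale0r.
Qed.

End Extension.

Section Basis.

Variables r s : nat.
Implicit Types D E : wdiagram r s.

Lemma wbdiag_span : <<[seq wbdiag delta D | D : wdiagram r s]>>%VS = fullv.
Proof.
apply/eqP; rewrite eqEsubv subvf /=.
pose X := [seq wbdiag delta D | D : wdiagram r s].
suff sub : (walled_aspace delta r s <= linfun vsval @: <<X>>)%VS.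
  apply/subvP=> x _; have /memv_imgP[y Xy] := subvP sub _ (subvsP x).
  by rewrite lfunE => /val_inj->.
apply/span_subvP=> _ /imageP[D _ ->].
have XD : wbdiag delta D \in <<X>>%VS by apply/memv_span/image_f.
by have := memv_img (linfun vsval) XD; rewrite lfunE.
Qed.

Lemma wbdiagM D E :
  wbdiag delta D * wbdiag delta E =
    delta ^+ loops D E *: wbdiag delta (WDiagram (dcomp_walled (wdiagramP D) (wdiagramP E))).
Proof. by apply: val_inj; rewrite /= bdiagM. Qed.

Lemma wbdiag1 : wbdiag delta (WDiagram (id_walled (r + s) r)) = 1.
Proof. exact/val_inj/esym/vsval1/walled_span1. Qed.

End Basis.

(** The hypotheses compare underlying diagrams, so that the proofs of walledness
    attached to them do not have to agree. *)
Lemma wmap_ahom r s r' s' (h : wdiagram r s -> wdiagram r' s') :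
    h (WDiagram (id_walled (r + s) r)) = id_diagram _ :> diagram _ ->
    (forall D E, h (WDiagram (dcomp_walled (wdiagramP D) (wdiagramP E))) =
       dcomp (h D) (h E) :> diagram _) ->
    (forall D E, loops (h D) (h E) = loops D E) ->
  exists f : 'AHom(wBrauer delta r s, wBrauer delta r' s'),
    forall D, f (wbdiag delta D) = wbdiag delta (h D).
Proof.
move=> h1 hM hl.
have [f fE] := linear_lfun (wextend_linear (fun D => wbdiag delta (h D))).
have fB D : f (wbdiag delta D) = wbdiag delta (h D) by rewrite fE wextendE.
suff fM : ahom_in fullv f by exists (AHom fM).
apply: (ahom_in_span (wbdiag_span r s)) => [_ _ /imageP[D _ ->] /imageP[E _ ->]|].
  rewrite wbdiagM linearZ /= !fB wbdiagM hl; congr (_ *: _).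
  by congr wbdiag; apply: val_inj; apply: hM.
by rewrite -!wbdiag1 fB; congr wbdiag; apply: val_inj; apply: h1.
Qed.

(** * The twisted tensor product *)

Section Product.

Variables r s n m : nat.
Implicit Types (D : wdiagram r s) (E : wdiagram n m).

Definition wmerge D E : wdiagram (r + n) (s + m) :=
  WDiagram (dmerge_walled (wdiagramP D) (wdiagramP E)).

Lemma wmerge_inj : injective (fun p => wmerge p.1 p.2).
Proof. by move=> [D E] [D' E'] /= /(congr1 val)/dmerge_inj[/val_inj-> /val_inj->]. Qed.

(** No closed curve arises, as each of the two parts of the stack contains an
    identity diagram. *)
Lemma boxtimesE D E : boxtimes delta D E = wbdiag delta (wmerge D E).
Proof.
rewrite /boxtimes wbdiagM /= loops_dmerge loopsd1 loops1d scale1r.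
by congr wbdiag; apply: val_inj; rewrite /= dcomp_dmerge dcompd1 dcomp1d.
Qed.

Lemma wzeta_iota D E :
  wbdiag delta (wzeta r s E) * wbdiag delta (wiota n m D) = boxtimes delta D E.
Proof.
rewrite boxtimesE wbdiagM /= loops_dmerge loopsd1 loops1d scale1r.
by congr wbdiag; apply: val_inj; rewrite /= dcomp_dmerge dcompd1 dcomp1d.
Qed.

Lemma wiota_ahom : exists f : 'AHom(wBrauer delta r s, wBrauer delta (r + n) (s + m)),
  forall D, f (wbdiag delta D) = wbdiag delta (wiota n m D).
Proof.
apply: wmap_ahom => [|D D'|D D'] /=; first exact: dmerge_id.
  by rewrite dcomp_dmerge dcomp1d.
by rewrite loops_dmerge loops1d addn0.
Qed.

Lemma wzeta_ahom : exists f : 'AHom(wBrauer delta n m, wBrauer delta (r + n) (s + m)),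
  forall E, f (wbdiag delta E) = wbdiag delta (wzeta r s E).
Proof.
apply: wmap_ahom => [|E E'|E E'] /=; first exact: dmerge_id.
  by rewrite dcomp_dmerge dcomp1d.
by rewrite loops_dmerge loops1d.
Qed.

End Product.
End Diagrams.

Theorem theorem3p6 (k : fieldType) (delta : k) (r s n m : nat) :
  exists U : {aspace wBrauer delta (r + n) (s + m)},
    [/\ U = twisted_tensor delta r s n m :> {vspace wBrauer delta (r + n) (s + m)},
        1 \in U &
        exists f : 'AHom(tensor (wBrauer delta r s) (wBrauer delta n m), subvs_of U),
          bijective f].
Proof.
have [phi phiE] := wiota_ahom delta r s n m.
have [psi psiE] := wzeta_ahom delta r s n m.
(* Both sides are linear in a and in b: it suffices to compare them on diagrams,
   first for a, then for b. *)
have comm a b : phi a * psi b = psi b * phi a.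
  suff /(_ a) : (amulr (psi b) \o phi)%VF =1 (amull (psi b) \o phi)%VF.
    by rewrite !lfunE /= !lfunE.
  apply: eq_on_span (wbdiag_span delta r s) _ => _ /imageP[D _ ->].
  rewrite !lfunE /= !lfunE /= phiE.
  suff /(_ b) : (amull (wbdiag delta (wiota n m D)) \o psi)%VF =1
      (amulr (wbdiag delta (wiota n m D)) \o psi)%VF.
    by rewrite !lfunE /= !lfunE.
  apply: eq_on_span (wbdiag_span delta n m) _ => _ /imageP[E _ ->].
  by rewrite !lfunE /= !lfunE /= psiE wzeta_iota.
have [f fE] := tensor_ahom comm.
have fB D E : f (tens (wbdiag delta D) (wbdiag delta E)) = wbdiag delta (wmerge D E).
  by rewrite fE phiE psiE -boxtimesE.
pose e (p : wdiagram r s * wdiagram n m) := tens (wbdiag delta p.1) (wbdiag delta p.2).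
have spanE : <<[seq e p | p : (wdiagram r s * wdiagram n m)%type]>>%VS = fullv.
  apply/eqP; rewrite eqEsubv subvf -(tens_span (wbdiag_span delta r s) (wbdiag_span delta n m)).
  apply/span_subvP=> _ /allpairsP[[_ _] /= [/imageP[D _ ->] /imageP[E _ ->] ->]].
  by apply/memv_span/(image_f e (x := (D, E))).
(* h reads off D and E from D + E; the value 0 at the other diagrams is only a
   default, as the image of f is spanned by the diagrams D + E. *)
pose h (C : wdiagram (r + n) (s + m)) : tensor _ _ :=
  if [pick p | wmerge p.1 p.2 == C] is Some p then e p else 0.
have f_inj : injective f.
  have [g gE] := linear_lfun (wextend_linear (delta := delta) h).
  suff fK : cancel f g by apply: can_inj fK.
  move=> x; have : (g \o f)%VF =1 \1%VF.
    apply: eq_on_span spanE _ => _ /imageP[[D E] _ ->].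
    rewrite !lfunE /= fB gE wextendE /h.
    by case: pickP => [p /eqP/wmerge_inj->|/(_ (D, E))] //=; rewrite eqxx.
  by move/(_ x); rewrite !lfunE.
have [U [UE U1 fU]] := ahom_corestrict f_inj.
exists U; split=> //; rewrite UE -spanE limg_span -map_comp.
by congr span; apply: eq_map => -[D E]; rewrite /= fB boxtimesE.
Qed.
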